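(* Let $(C_\bullet,\partial,\delta)$ and $(\bar C_\bullet,\partial,\delta)$ be para-twin complexes of $k$-modules, and let $f:C_\bullet\to\bar C_\bullet$, $g:\bar C_\bullet\to C_\bullet$ (degree $0$) and $\varphi:C_\bullet\to C_{\bullet+1}$ be $k$-linear maps such that $gf=1+\partial\varphi+\varphi\partial$ and such that, for every $m\ge0$, $(\delta\varphi)^j=(\varphi\delta)^j=0$ on $C_m$ for all sufficiently large $j$. Let $\tilde\varphi,\tilde f,\tilde g,\tilde\delta$ and $\Delta$ be defined as in the context. Suppose that $f$ and $g$ are compatible with the operators $\partial$ (i.e. $f\partial=\partial f$, $g\partial=\partial g$), that $\varphi$ is special (i.e. $f\varphi=0$, $\varphi g=0$, $\varphi^2=0$), and that $\varphi$ is $\Delta$-compatible (i.e. $\varphi\Delta=\Delta\varphi$). Then $$\tilde f(\partial+\delta)=(\partial+\tilde\delta)\tilde f,\qquad \tilde g(\partial+\tilde\delta)=(\partial+\delta)\tilde g,$$ $$\tilde g\tilde f=1+(\partial+\delta)\tilde\varphi+\tilde\varphi(\partial+\delta),\qquad \tilde f\tilde g=fg,$$ $$\tilde\delta^2+\partial\tilde\delta+\tilde\delta\partial=f\Delta g .$$ In addition, the chain homotopy $\tilde\varphi$ is special, i.e. $\tilde f\tilde\varphi=0$, $\tilde\varphi\tilde g=0$, $\tilde\varphi^2=0$.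
   Context: $k$ is a unital ring, not assumed commutative; $k$-modules are left modules. A para-twin complex $(C_\bullet,\partial,\delta)$ consists of $k$-modules $C_m$, $m\ge0$, and $k$-linear maps $\partial,\delta:C_\bullet\to C_{\bullet-1}$; no relation (such as $\partial^2=0$ or $\delta^2=0$) is assumed. Definitions: $\tilde\varphi=\sum_{j\ge0}\varphi(\delta\varphi)^j=\sum_{j\ge0}(\varphi\delta)^j\varphi:C_\bullet\to C_{\bullet+1}$; $\tilde f=f(1+\delta\tilde\varphi):C_\bullet\to\bar C_\bullet$; $\tilde g=(1+\tilde\varphi\delta)g:\bar C_\bullet\to C_\bullet$; $\tilde\delta=f(\delta+\delta\tilde\varphi\delta)g:\bar C_\bullet\to\bar C_{\bullet-1}$, where $\delta$ is the operator on $C_\bullet$; $\Delta=\delta^2+\partial\delta+\delta\partial$ on $C_\bullet$. *)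

(* Defs.v *)
From mathcomp Require Import all_boot all_algebra.
From mathcomp Require Import classical_sets fsbigop.

Set Implicit Arguments.
Unset Strict Implicit.
Unset Printing Implicit Defensive.
Import GRing.Theory.
Local Open Scope classical_set_scope.
Local Open Scope ring_scope.

(* The graded module is concentrated in degrees m >= 0, so both operators     *)
(* vanish on C_0; only their components C_(m+1) -> C_m are recorded.          *)
Record paraTwin (k : pzRingType) := ParaTwin {
  pt_mod :> nat -> lmodType k;
  pt_partial : forall m, {linear pt_mod m.+1 -> pt_mod m};
  pt_delta : forall m, {linear pt_mod m.+1 -> pt_mod m} }.

Arguments pt_partial {k} C m : rename.
Arguments pt_delta {k} C m : rename.

(* The composite P D at x : A m, where D lowers the degree of B: D lands in   *)
(* degree -1, hence is 0, on A 0.                                             *)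
Definition comp_lowered (k : pzRingType) (A B E : nat -> lmodType k)
    (P : forall m, B m -> E m.+1) (D : forall m, A m.+1 -> B m) (m : nat) :
    A m -> E m :=
  match m with
  | 0 => fun=> 0
  | n.+1 => fun x => P n (D n x)
  end.

Section Perturbation.
Variables (k : pzRingType) (C Cb : paraTwin k).
Local Notation delta := (pt_delta C).

Definition pt_Delta (m : nat) (x : C m.+2) : C m :=
  delta m (delta m.+1 x) + pt_partial C m (delta m.+1 x)
  + delta m (pt_partial C m.+1 x).

Variables (f : forall m, {linear C m -> Cb m}).
Variables (g : forall m, {linear Cb m -> C m}).
Variables (phi : forall m, {linear C m -> C m.+1}).

Definition delta_phi (m : nat) (x : C m) : C m := delta m (phi m x).

Definition phi_delta (m : nat) (x : C m) : C m :=
  comp_lowered phi delta x.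

Definition phi_partial (m : nat) (x : C m) : C m :=
  comp_lowered phi (pt_partial C) x.

(* phi Delta has degree -1 and is 0 on C_1, where Delta lands in degree -1.   *)
Definition phi_Delta (m : nat) (x : C m.+1) : C m :=
  @comp_lowered k (fun n => C n.+1) C C phi pt_Delta m x.

(* The sum is over the finitely many j with a nonzero term.                   *)
Definition tphi (m : nat) (x : C m) : C m.+1 :=
  \sum_(j \in [set: nat]) phi m (iter j (@delta_phi m) x).

Lemma tphiE (m : nat) (x : C m) :
  tphi x = \sum_(j \in [set: nat]) iter j (@phi_delta m.+1) (phi m x).
Proof.
apply: eq_fsbigr => j _.
by elim: j => //= j <-.
Qed.

Definition tphi_delta (m : nat) (x : C m) : C m :=
  comp_lowered tphi delta x.

Definition tphi_partial_delta (m : nat) (x : C m) : C m :=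
  comp_lowered tphi (fun n (z : C n.+1) => pt_partial C n z + delta n z) x.

Definition tf (m : nat) (x : C m) : Cb m := f m (x + delta m (tphi x)).

Definition tg (m : nat) (y : Cb m) : C m := g m y + tphi_delta (g m y).

Definition tdelta (m : nat) (y : Cb m.+1) : Cb m :=
  f m (delta m (g m.+1 y) + delta m (tphi (delta m (g m.+1 y)))).

End Perturbation.

(* Main.v *)
Require Import Defs.
From mathcomp Require Import all_boot all_algebra.
From mathcomp Require Import fsbigop.

Set Implicit Arguments.
Unset Strict Implicit.
Unset Printing Implicit Defensive.
Import GRing.Theory.
Local Open Scope ring_scope.

(** Write [D], [d], [h], [H] for the operators partial, delta, phi and tphi on
[C], B = D + d and Delta = dd + Dd + dD. Nilpotency makes [H] a finite
geometric series, so that it is additive and satisfies the two fixed-point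
equations H = h (1 + dH) = (1 + Hd) h. Everything else is formal.

Since tphi begins and ends with phi, the vanishing of f h, h g and h h gives
f H = 0, H g = 0 and H H = 0; hence tphi is special and tf tg = f g. The hypothesis h Delta = Delta h enters only through two vanishing
statements: H Delta w = 0 as soon as h w = 0 ([tphi_Delta_eq0]), because
H Delta = (1 + Hd) Delta h, and f Delta H = 0 ([f_Delta_tphi]), because
Delta H = h Delta (1 + dH).

For the homotopy, the two intertwining relations and the square of the perturbed
differential on the target, the point is to evaluate
g f = 1 + Dh + hD only on vectors where h is already known. On y = (1 + dH) x
one has h y = H x, so g f y = y + DHx + hDy; on d z, where z = tg y, one has
h d z = H d g y, so g f d z = d z + D(H d g y) + hDdz. After 1 + dH or 1 + Hd is
applied, the fixed-point equations turn h into H and the terms quadratic in the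
operators regroup into a single Delta, which the two vanishing statements
remove. *)

Section Perturbation.
Variables (k : pzRingType) (C Cb : paraTwin k).
Variables (f : forall m, {linear C m -> Cb m}).
Variables (g : forall m, {linear Cb m -> C m}).
Variables (phi : forall m, {linear C m -> C m.+1}).

Local Notation D := (pt_partial C _).
Local Notation d := (pt_delta C _).
Local Notation h := (phi _).
Local Notation H := (tphi phi).

Hypothesis nilp : forall m, exists N, forall j, (N <= j)%N -> forall x : C m,
  iter j (@delta_phi k C phi m) x = 0.

(** * The geometric series *)

(** Every large enough truncation computes the series; leaving the truncation
free is what allows the sum to be shifted by one in the equations below. *)
Lemma tphi_big m : exists N, forall M, (N <= M)%N -> forall x : C m,
  H x = \sum_(j < M) h (iter j (@delta_phi k C phi m) x).
Proof.
have [N nilN] := nilp m; exists N => M leNM x.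
rewrite (fsbig_ord _ _ (fun j => h (iter j (@delta_phi k C phi m) x))).
rewrite /tphi; apply/esym/fsbig_widen => // j [_ /= /negP].
by rewrite -leqNgt => leMj; rewrite nilN ?linear0 // (leq_trans leNM).
Qed.

Lemma iter_delta_phiD m j (x y : C m) :
  iter j (@delta_phi k C phi m) (x + y)
  = iter j (@delta_phi k C phi m) x + iter j (@delta_phi k C phi m) y.
Proof. by elim: j => //= j ->; rewrite /delta_phi !linearD. Qed.

Lemma tphiD m (x y : C m) : H (x + y) = H x + H y.
Proof.
have [N tphiN] := tphi_big m.
rewrite !(tphiN N) // -big_split; apply: eq_bigr => j _ /=.
by rewrite iter_delta_phiD linearD.
Qed.

Lemma tphi0 m : H (0 : C m) = 0.
Proof. by apply: (addrI (H 0)); rewrite -tphiD !addr0. Qed.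

Lemma tphi_fixr m (x : C m) : H x = h x + H (d (h x)).
Proof.
have [N tphiN] := tphi_big m.
rewrite (tphiN N.+1) // (tphiN N) // big_ord_recl; congr (_ + _).
by apply: eq_bigr => j _; rewrite iterSr.
Qed.

Lemma tphi_fixl m (x : C m) : H x = h (x + d (H x)).
Proof.
have [N tphiN] := tphi_big m.
rewrite [LHS](tphiN N.+1) // (tphiN N) // big_ord_recl linearD !linear_sum.
by congr (_ + _); apply: eq_bigr.
Qed.

(** * Speciality of the perturbed homotopy *)

Hypothesis f_phi : forall m (x : C m), f m.+1 (h x) = 0.
Hypothesis phi_g : forall m (y : Cb m), h (g m y) = 0.
Hypothesis phi_phi : forall m (x : C m), h (h x) = 0.

Lemma tphi_eq0 m (x : C m) : h x = 0 -> H x = 0.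
Proof. by move=> hx0; rewrite tphi_fixr hx0 linear0 tphi0 addr0. Qed.

Lemma phi_tphi m (x : C m) : h (H x) = 0.
Proof. by rewrite tphi_fixl phi_phi. Qed.

Lemma tphi_tphi m (x : C m) : H (H x) = 0.
Proof. exact/tphi_eq0/phi_tphi. Qed.

Lemma f_tphi m (x : C m) : f m.+1 (H x) = 0.
Proof. by rewrite tphi_fixl f_phi. Qed.

Lemma tphi_g m (y : Cb m) : H (g m y) = 0.
Proof. exact/tphi_eq0/phi_g. Qed.

Lemma tf_tphi m (x : C m) : tf f phi (H x) = 0.
Proof. by rewrite /tf tphi_tphi linear0 addr0 f_tphi. Qed.

Lemma tphi_tg m (y : Cb m) : H (tg g phi y) = 0.
Proof.
case: m y => [|m] y; rewrite /tg /tphi_delta /= tphiD tphi_g add0r ?tphi0 //.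
exact: tphi_tphi.
Qed.

Lemma phi_tg m (y : Cb m) : h (tg g phi y) = 0.
Proof.
case: m y => [|m] y; rewrite /tg /tphi_delta /= linearD phi_g add0r ?linear0 //.
exact: phi_tphi.
Qed.

Lemma f_tg m (y : Cb m) : f m (tg g phi y) = f m (g m y).
Proof.
case: m y => [|m] y; rewrite /tg /tphi_delta /= ?addr0 //.
by rewrite linearD f_tphi addr0.
Qed.

Lemma tf_tg m (y : Cb m) : tf f phi (tg g phi y) = f m (g m y).
Proof. by rewrite /tf tphi_tg linear0 addr0 f_tg. Qed.

(** * Consequences of Delta-compatibility *)

Hypothesis phi_DeltaC : forall m (x : C m.+1), phi_Delta phi x = pt_Delta (h x).

Lemma pt_Delta0 m : pt_Delta (0 : C m.+2) = 0.
Proof. by rewrite /pt_Delta !linear0 !addr0. Qed.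

Lemma pt_DeltaD m (x y : C m.+2) :
  pt_Delta (x + y) = pt_Delta x + pt_Delta y.
Proof. by rewrite /pt_Delta !linearD /= (AC (2*2*2) (1*3*5*(2*4*6))). Qed.

Lemma tphi_Delta_eq0 m (w : C m.+2) : h w = 0 -> H (pt_Delta w) = 0.
Proof.
move=> hw0; apply: tphi_eq0.
by have := phi_DeltaC w; rewrite hw0 pt_Delta0.
Qed.

Lemma f_Delta_tphi m (x : C m.+1) : f m (pt_Delta (H x)) = 0.
Proof.
rewrite tphi_fixl -phi_DeltaC.
(* In lowest degree phi Delta is zero rather than a value of phi. *)
by case: m x => [|m] x; rewrite /phi_Delta /= ?linear0 ?f_phi.
Qed.

(** * The perturbed contraction *)

Hypothesis gfE : forall m (x : C m),
  g m (f m x) = x + D (h x) + phi_partial phi x.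
Hypothesis f_partial : forall m (x : C m.+1),
  f m (D x) = pt_partial Cb m (f m.+1 x).
Hypothesis g_partial : forall m (y : Cb m.+1),
  g m (pt_partial Cb m y) = D (g m.+1 y).

Lemma tfD m (x y : C m) : tf f phi (x + y) = tf f phi x + tf f phi y.
Proof. by rewrite /tf tphiD !linearD /= addrACA. Qed.

Lemma tf_delta_phi m (x : C m) : tf f phi (d (h x)) = f m (d (H x)).
Proof. by rewrite /tf -linearD -tphi_fixr. Qed.

Lemma tdeltaE_tf m (y : Cb m.+1) :
  tdelta f g phi y = tf f phi (d (g m.+1 y)).
Proof. by []. Qed.

Lemma tdeltaE_tg m (y : Cb m.+1) :
  tdelta f g phi y = f m (d (tg g phi y)).
Proof. by rewrite /tdelta /tg [in RHS]linearD. Qed.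

Lemma gf_tf m (x : C m) :
  g m (tf f phi x)
  = x + d (H x) + D (H x) + phi_partial phi (x + d (H x)).
Proof. by rewrite /tf gfE -tphi_fixl. Qed.

Lemma phi_delta_tg m (y : Cb m.+1) :
  h (d (tg g phi y)) = H (d (g m.+1 y)).
Proof. by rewrite [RHS]tphi_fixl /tg linearD. Qed.

(** Neither summand on the left is governed by z = tg y alone: g f d z contains
D H d g y, and only together with g D y does it make up D z. *)
Lemma g_partial_tdelta m (y : Cb m.+1) :
  g m (pt_partial Cb m y + tdelta f g phi y)
  = D (tg g phi y) + d (tg g phi y) + phi_partial phi (d (tg g phi y)).
Proof.
have Dtg : D (tg g phi y) = D (g m.+1 y) + D (H (d (g m.+1 y))).
  by rewrite -linearD.
rewrite linearD g_partial tdeltaE_tg gfE phi_delta_tg Dtg.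
by rewrite (AC (1*3) ((1*3)*2*4)).
Qed.

(** The terms collected on y = (1 + dH) x differ from the total differential
of x only by Delta H x, which f and H both annihilate. *)
Lemma total_regroup m (x : C m.+1) :
  D (x + d (H x)) + d (x + d (H x)) + d (D (H x))
  = D x + d x + pt_Delta (H x).
Proof. by rewrite /pt_Delta !linearD /= (AC (2*2*1) (1*3*(4*2*5))). Qed.

Lemma tphi_total m (x : C m.+1) :
  H (D x + d x) = H (D (x + d (H x)) + d (x + d (H x)) + d (D (H x))).
Proof.
by rewrite total_regroup [RHS]tphiD tphi_Delta_eq0 ?addr0 ?phi_tphi.
Qed.

Lemma f_total m (x : C m.+1) :
  f m (D x + d x) = f m (D (x + d (H x)) + d (x + d (H x)) + d (D (H x))).
Proof. by rewrite total_regroup [RHS]linearD f_Delta_tphi addr0. Qed.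

(** With y = (1 + dH) x, the terms of td tf x behind dH are
dy + dDHx + Dy = B x + Delta H x, and H Delta H = 0. *)
Lemma tf_total m (x : C m.+1) :
  tf f phi (D x + d x)
  = pt_partial Cb m (tf f phi x) + tdelta f g phi (tf f phi x).
Proof.
rewrite tdeltaE_tf gf_tf [phi_partial _ _]/= -f_partial.
rewrite [LHS]linearD /= f_total tphi_total.
move: (x + d (H x)) => y.
rewrite [d (_ + h _)]linearD [d (y + _)]linearD !tfD tf_delta_phi /tf.
rewrite !(tphiD, linearD) /=.
by rewrite (AC (3*3) (1*((2*5)*(3*6)*4))).
Qed.

(** The product (1 + Hd) (1 + Dh + hD) (1 + dH) expands, by the fixed-point
equations, to 1 + BH + HB + H Delta H, and H Delta H = 0. *)
Lemma tg_tf m (x : C m) :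
  tg g phi (tf f phi x)
  = x + (D (H x) + d (H x)) + tphi_partial_delta phi x.
Proof.
rewrite /tg gf_tf; case: m x => [|m] x.
  rewrite /tphi_delta /tphi_partial_delta /phi_partial /= !addr0.
  by rewrite -addrA [d _ + _]addrC.
rewrite /tphi_delta /tphi_partial_delta /phi_partial /= tphi_total.
have -> : x + (D (H x) + d (H x)) = x + d (H x) + D (H x).
  by rewrite -addrA [d _ + _]addrC.
move: (x + d (H x)) => y.
rewrite !(tphiD, linearD) /= [H (D y)]tphi_fixr.
by rewrite (AC (3*3) ((1*2)*(3*6*4*5))).
Qed.

(** With z = tg y, the left side is B z plus H applied to
dDz + ddz + Ddz = Delta z, and H Delta z = 0 because h z = 0. *)
Lemma tg_total m (y : Cb m.+1) :
  tg g phi (pt_partial Cb m y + tdelta f g phi y)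
  = D (tg g phi y) + d (tg g phi y).
Proof.
rewrite {1}/tg g_partial_tdelta; have := phi_tg y.
move: (tg g phi y) => {y}; case: m => [|m] z hz0.
  by rewrite /tphi_delta /phi_partial /= !addr0.
rewrite /tphi_delta /phi_partial /=.
rewrite -addrA -[RHS]addr0 -(tphi_Delta_eq0 hz0) /pt_Delta; congr (_ + _).
rewrite !(tphiD, linearD) /= [H (D (d z))]tphi_fixr.
by rewrite (AC (1*3) (3*(1*4)*2)).
Qed.

(** With z = tg y, collecting terms gives f (1 + dH) Delta z = f Delta z, and
z differs from g y by a value of H, which f Delta kills. *)
Lemma tdelta_curvature m (y : Cb m.+2) :
  tdelta f g phi (tdelta f g phi y)
  + pt_partial Cb m (tdelta f g phi y)
  + tdelta f g phi (pt_partial Cb m.+1 y)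
  = f m (pt_Delta (g m.+2 y)).
Proof.
have -> : f m (pt_Delta (g m.+2 y)) = tf f phi (pt_Delta (tg g phi y)).
  rewrite /tf tphi_Delta_eq0 ?phi_tg // linear0 addr0 /tg pt_DeltaD.
  by rewrite [RHS]linearD /= f_Delta_tphi addr0.
rewrite addrAC [X in X + _]addrC 2![tdelta _ _ _ _ in X in X + _]tdeltaE_tf.
rewrite -tfD -linearD -linearD g_partial_tdelta.
rewrite tdeltaE_tg -f_partial /phi_partial /=.
move: (tg g phi y) => z.
rewrite /pt_Delta 2!linearD !tfD tf_delta_phi.
rewrite [tf f phi (D (d z))]linearD /=.
by rewrite (AC (3*1) (2*(4*3)*1)).
Qed.

End Perturbation.

Theorem lemma7p1 (k : pzRingType) (C Cb : paraTwin k)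
    (f : forall m, {linear C m -> Cb m})
    (g : forall m, {linear Cb m -> C m})
    (phi : forall m, {linear C m -> C m.+1})
    (gfE : forall m (x : C m),
       g m (f m x) = x + pt_partial C m (phi m x) + phi_partial phi x)
    (nilp : forall m, exists N, forall j, (N <= j)%N -> forall x : C m,
       iter j (@delta_phi k C phi m) x = 0 /\
       iter j (@phi_delta k C phi m) x = 0)
    (f_partial : forall m (x : C m.+1),
       f m (pt_partial C m x) = pt_partial Cb m (f m.+1 x))
    (g_partial : forall m (y : Cb m.+1),
       g m (pt_partial Cb m y) = pt_partial C m (g m.+1 y))
    (f_phi : forall m (x : C m), f m.+1 (phi m x) = 0)
    (phi_g : forall m (y : Cb m), phi m (g m y) = 0)
    (phi_phi : forall m (x : C m), phi m.+1 (phi m x) = 0)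
    (phi_DeltaC : forall m (x : C m.+1),
       phi_Delta phi x = pt_Delta (phi m.+1 x)) :
  (forall m (x : C m.+1),
     tf f phi (pt_partial C m x + pt_delta C m x)
     = pt_partial Cb m (tf f phi x) + tdelta f g phi (tf f phi x)) /\
  (forall m (y : Cb m.+1),
     tg g phi (pt_partial Cb m y + tdelta f g phi y)
     = pt_partial C m (tg g phi y) + pt_delta C m (tg g phi y)) /\
  (forall m (x : C m),
     tg g phi (tf f phi x)
     = x + (pt_partial C m (tphi phi x) + pt_delta C m (tphi phi x))
       + tphi_partial_delta phi x) /\
  (forall m (y : Cb m), tf f phi (tg g phi y) = f m (g m y)) /\
  (forall m (y : Cb m.+2),
     tdelta f g phi (tdelta f g phi y)
     + pt_partial Cb m (tdelta f g phi y)
     + tdelta f g phi (pt_partial Cb m.+1 y)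
     = f m (pt_Delta (g m.+2 y))) /\
  (forall m (x : C m), tf f phi (tphi phi x) = 0) /\
  (forall m (y : Cb m), tphi phi (tg g phi y) = 0) /\
  (forall m (x : C m), tphi phi (tphi phi x) = 0).
Proof.
have nil m : exists N, forall j, (N <= j)%N -> forall x : C m,
    iter j (@delta_phi k C phi m) x = 0.
  have [N nilN] := nilp m.
  by exists N => j leNj x; have [] := nilN j leNj x.
split; first by move=> m x; exact: tf_total.
split; first by move=> m y; exact: tg_total.
split; first by move=> m x; exact: tg_tf.
split; first by move=> m y; exact: tf_tg.
split; first by move=> m y; exact: tdelta_curvature.
split; first by move=> m x; exact: tf_tphi.
split; first by move=> m y; exact: tphi_tg.
by move=> m x; exact: tphi_tphi.
Qed.
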